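(* Let $A\in\mathbb{C}^{N\times N}$, let $v\in\mathbb{C}^N$ be nonzero with $\beta=\|v\|$, let $\tau>0$, and let $AV_m=V_mH_m+h_{m+1,m}v_{m+1}e_m^T$ be the Arnoldi decomposition of $A$ with starting vector $v$. Then the error $E_m(e^z,\tau)=e^{-\tau A}v-\beta V_me^{-\tau H_m}e_1$ satisfies $$\|E_m(e^z,\tau)\|\le \tau\beta h_{m+1,m}\max_{0\le t\le\tau}\bigl|e_m^Te^{-tH_m}e_1\bigr|\;\frac{e^{\tau\mu_2}-1}{\tau\mu_2},$$ where $\mu_2=\mu_2[-A]$ is the 2-logarithmic norm of $-A$.
   Context: $\|\cdot\|$ is the Euclidean vector norm and matrix 2-norm. In the Arnoldi decomposition, the columns of $V_m=[v_1,\ldots,v_m]$ form an orthonormal basis of the Krylov subspace $\mathcal{K}_m(A,v)=\mathrm{span}\{v,Av,\ldots,A^{m-1}v\}$ with $v_1=v/\|v\|$, $v_{m+1}$ is a unit vector orthogonal to the columns of $V_m$, $H_m\in\mathbb{C}^{m\times m}$ is an unreduced upper Hessenberg matrix, $h_{m+1,m}>0$, and $e_j$ is the $j$th coordinate vector of $\mathbb{R}^m$. The 2-logarithmic norm is $\mu_2[B]=\lim_{h\to0+}\frac{\|I+hB\|-1}{h}=\lambda_{\max}\bigl(\frac{B+B^*}{2}\bigr)$. When $\mu_2=0$ the quotient $\frac{e^{\tau\mu_2}-1}{\tau\mu_2}$ is interpreted as its limit $1$. *)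

(* Defs.v *)
From HB Require Import structures.
From mathcomp Require Import all_boot all_order all_algebra.
From mathcomp Require Import all_classical all_reals all_analysis.
From mathcomp Require Import complex.

Set Implicit Arguments.
Unset Strict Implicit.
Unset Printing Implicit Defensive.

Import Order.TTheory GRing.Theory Num.Theory.
Import numFieldNormedType.Exports.

Local Open Scope classical_set_scope.
Local Open Scope complex_scope.
Local Open Scope sesquilinear_scope.
Local Open Scope ring_scope.

(* The topology of R[i] is that of the modulus; matrices over R[i] inherit
   the library's (entrywise) matrix topology from it. *)
HB.instance Definition _ (R : rcfType) := NormedModule.copy R[i] R[i]^o.

Section Definitions.
Variable R : realType.

(* [Normc.normc] is the R-valued modulus; [`|z|] lives in R[i]. *)
Definition vnorm2 n (x : 'cV[R[i]]_n) : R :=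
  Num.sqrt (\sum_i Normc.normc (x i 0) ^+ 2).

Definition mnorm2 m n (B : 'M[R[i]]_(m, n)) : R :=
  sup [set vnorm2 (B *m x) | x in [set x : 'cV[R[i]]_n | vnorm2 x = 1]].

Definition expmx n (B : 'M[R[i]]_n) : 'M[R[i]]_n :=
  limn (series (fun k : nat => (k`!%:R)^-1 *: B ^+ k)).

Definition lognorm2 n (B : 'M[R[i]]_n) : R :=
  lim ((mnorm2 (1%:M + h%:C *: B) - 1) / h @[h --> (0 : R)^'+]).

(* (e^x - 1) / x, extended by its limit at 0 *)
Definition phi1 (x : R) : R := if x == 0 then 1 else (expR x - 1) / x.

Definition krylov N (A : 'M[R[i]]_N) (v : 'cV[R[i]]_N) (m : nat) :
    {vspace 'cV[R[i]]_N} :=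
  <<[seq A ^+ j *m v | j <- iota 0 m]>>%VS.

Definition unreduced_hessenberg m (H : 'M[R[i]]_m) : Prop :=
  (forall i j : 'I_m, (j.+1 < i)%N -> H i j = 0) /\
  (forall i j : 'I_m, i = j.+1 :> nat -> H i j != 0).

(* The Krylov dimension is m = k.+1, so that v_1, e_1 and e_m make sense: they
   are the column [ord0] of V and the unit vectors at [ord0] and [ord_max].
   [h] and [w] stand for h_{m+1,m} and v_{m+1}. *)
Record arnoldi N k (A : 'M[R[i]]_N) (v : 'cV[R[i]]_N) (V : 'M[R[i]]_(N, k.+1))
    (H : 'M[R[i]]_k.+1) (h : R) (w : 'cV[R[i]]_N) : Prop := Arnoldi {
  arnoldi_orthonormal : V ^t* *m V = 1%:M;
  arnoldi_basis : basis_of (krylov A v k.+1) [seq col j V | j <- enum 'I_k.+1];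
  arnoldi_first : col ord0 V = (vnorm2 v)^-1%:C *: v;
  arnoldi_next_unit : vnorm2 w = 1;
  arnoldi_next_orthogonal : V ^t* *m w = 0;
  arnoldi_hessenberg : unreduced_hessenberg H;
  arnoldi_next_gt0 : 0 < h;
  arnoldi_relation :
    A *m V = V *m H + h%:C *: (w *m (delta_mx ord_max 0 : 'cV_k.+1)^T)
}.

End Definitions.

(* Main.v *)
Require Import Defs.
From mathcomp Require Import all_boot all_order all_algebra.
From mathcomp Require Import all_classical all_reals all_analysis.
From mathcomp Require Import complex.
From mathcomp Require Import ring lra.

Set Implicit Arguments.
Unset Strict Implicit.
Unset Printing Implicit Defensive.

Import Order.TTheory GRing.Theory Num.Theory.
Import numFieldNormedType.Exports.

Local Open Scope classical_set_scope.
Local Open Scope complex_scope.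
Local Open Scope ring_scope.

(* The error curve y(t) = e^{-tA} v - beta V e^{-tH} e_1 starts at 0 and, by the
   Arnoldi relation, solves y' = -A y - beta h (e_m^T e^{-tH} e_1) w.  Since
   Re <y, B y> <= mu_2[B] |y|^2, the function |y| satisfies
   |y|' <= mu_2[-A] |y| + beta h M, and integrating this gives the bound.
   Derivatives of t |-> e^{tB} are obtained from the real power series
   t |-> Re (u e^{tB} x), one for each row u and column x. *)

(** * Matrix exponential: convergence, value at zero and derivative *)

Section MatrixExponential.
Variable R : realType.
Local Notation C := R[i].
Implicit Types (z : C) (t : R).

Lemma Re_addc : {morph (@complex.Re R) : x y / x + y}.
Proof. by move=> [? ?] [? ?]. Qed.

Lemma Im_addc : {morph (@complex.Im R) : x y / x + y}.
Proof. by move=> [? ?] [? ?]. Qed.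

Lemma Re_mulc (x y : C) : complex.Re (x * y)
  = complex.Re x * complex.Re y - complex.Im x * complex.Im y.
Proof. by case: x y => [? ?] [? ?]. Qed.

Lemma Re_scalec (a : R) z : complex.Re (a%:C * z) = a * complex.Re z.
Proof. by rewrite Re_mulc /= mul0r subr0. Qed.

Lemma Im_scalec (a : R) z : complex.Im (a%:C * z) = a * complex.Im z.
Proof. by case: z => ? ? /=; rewrite mul0r addr0. Qed.

Lemma Re_sumc (I : Type) (r : seq I) (P : pred I) (F : I -> C) :
  complex.Re (\sum_(i <- r | P i) F i) = \sum_(i <- r | P i) complex.Re (F i).
Proof. exact: (big_morph _ Re_addc). Qed.

Lemma normc_ge_Re z : `|complex.Re z| <= Normc.normc z.
Proof.
by case: z => a b /=; rewrite -sqrtr_sqr ler_wsqrtr// lerDl sqr_ge0.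
Qed.

Lemma normc_le_ReIm z :
  Normc.normc z <= `|complex.Re z| + `|complex.Im z|.
Proof.
case: z => a b /=; rewrite -[leRHS]ger0_norm ?addr_ge0// -sqrtr_sqr.
rewrite ler_wsqrtr// sqrrD !real_normK ?num_real// lerD2r lerDl.
by rewrite mulrn_wge0// mulr_ge0.
Qed.

Lemma cvg_cmx m n (S : nat -> 'M[C]_(m, n)) (L : 'M[C]_(m, n)) :
  (forall i j, complex.Re (S k i j) @[k --> \oo] --> complex.Re (L i j)) ->
  (forall i j, complex.Im (S k i j) @[k --> \oo] --> complex.Im (L i j)) ->
  S k @[k --> \oo] --> L.
Proof.
move=> cR cI; apply/cvg_ballP => e e0.
(* Radii live in [R[i]], where being positive forces the imaginary part to vanish; each radius
   therefore comes from a real one. *)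
have [e' e'0 ee'] : exists2 e' : R, 0 < e' & e = e'%:C.
  by case: e e0 => a b; rewrite ltcE /= => /andP[/eqP -> a0]; exists a.
rewrite {}ee' in e0 *.
suff : \forall k \near \oo, forall i j,
    ball (L i j) e'%:C (S k i j) by apply: filterS => k Sk; split.
apply: filter_forall => i; apply: filter_forall => j.
move/cvgrPdist_lt: (cR i j) => /(_ _ (divr_gt0 e'0 (ltr0n _ 2))) HR.
move/cvgrPdist_lt: (cI i j) => /(_ _ (divr_gt0 e'0 (ltr0n _ 2))) HI.
near=> k.
rewrite -ball_normE /ball_/=.
change ((Normc.normc (L i j - S k i j))%:C < e'%:C); rewrite ltcR.
apply: le_lt_trans (normc_le_ReIm _) _.
rewrite Re_addc Im_addc !raddfN /= (splitr e') ltrD//.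
  by near: k; exact: HR.
by near: k; exact: HI.
Unshelve. all: by end_near. Qed.

(** Taylor coefficients at 0 of the real function t |-> Re (u e^{tB} x). *)
Definition ecoef n (B : 'M[C]_n) (u : 'rV[C]_n) (x : 'cV[C]_n) : nat -> R :=
  fun k => complex.Re ((u *m B ^+ k *m x) 0 0) / k`!%:R.

(** The factor k+1 from differentiation cancels against (k+1)!, and the extra power of [B] is
    absorbed into [u]. The family is thus closed under differentiation, so one convergence lemma
    serves all derivatives. *)
Lemma pseries_diffs_ecoef n (B : 'M[C]_n) u x :
  pseries_diffs (ecoef B u x) = ecoef B (u *m B) x.
Proof.
apply/funext => k; rewrite /pseries_diffs /ecoef -mulmxA exprS.
rewrite -!mulmxA mulrCA factS natrM invfM mulVKf //.
Qed.

Lemma normc_ge0 z : 0 <= Normc.normc z.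
Proof. by case: z => a b; exact: sqrtr_ge0. Qed.

Lemma normc_sum (I : Type) (r : seq I) (P : pred I) (F : I -> C) :
  Normc.normc (\sum_(i <- r | P i) F i) <=
  \sum_(i <- r | P i) Normc.normc (F i).
Proof.
elim/big_ind2: _ => [|x a y b xa yb|//]; first by rewrite Normc.normc0.
exact: le_trans (le_normcD _ _) (lerD xa yb).
Qed.

Lemma normc_exprmx n (B : 'M[C]_n) k i j :
  Normc.normc ((B ^+ k) i j) <= (\sum_i \sum_j Normc.normc (B i j)) ^+ k.
Proof.
elim: k i j => [|k IH] i j.
  rewrite !expr0 mxE; case: eqP => _.
    by rewrite mulr1n Normc.normc1.
  by rewrite mulr0n Normc.normc0.
rewrite !exprS mxE (le_trans (normc_sum _ _ _))//.
apply: (@le_trans _ _ (\sum_l Normc.normc (B i l) *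
    (\sum_i \sum_j Normc.normc (B i j)) ^+ k)).
  by apply: ler_sum => l _; rewrite Normc.normcM ler_wpM2l ?normc_ge0// IH.
rewrite -mulr_suml ler_wpM2r//.
  rewrite exprn_ge0// sumr_ge0// => ? _.
  by rewrite sumr_ge0// => ? _; exact: normc_ge0.
rewrite [leRHS](bigD1 i)//= lerDl sumr_ge0// => ? _.
by rewrite sumr_ge0// => ? _; exact: normc_ge0.
Qed.

Lemma mulmx_row_col m n (M : 'M[C]_(m, n)) (u : 'rV[C]_m) (x : 'cV[C]_n) :
  (u *m M *m x) 0 0 = \sum_i \sum_j u 0 i * x j 0 * M i j.
Proof.
rewrite mxE exchange_big /=; apply: eq_bigr => j _.
by rewrite mxE mulr_suml; apply: eq_bigr => i _; rewrite mulrAC.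
Qed.

(** Comparison with [d] times the exponential series at [c * |t|]: the entries of [B ^+ k] are at
    most [c ^+ k], where [c] is the sum of the moduli of the entries of [B]. *)
Lemma is_cvg_pseries_ecoef n (B : 'M[C]_n) u x t :
  cvgn (pseries (ecoef B u x) t).
Proof.
pose c := \sum_i \sum_j Normc.normc (B i j).
pose d := \sum_i \sum_j Normc.normc (u 0 i * x j 0).
have c0 : 0 <= c.
  by rewrite sumr_ge0// => ? _; rewrite sumr_ge0// => ? _; exact: normc_ge0.
have d0 : 0 <= d.
  by rewrite sumr_ge0// => ? _; rewrite sumr_ge0// => ? _; exact: normc_ge0.
apply: normed_cvg; rewrite /normed_series_of /=.
apply: (@series_le_cvg _ _ (fun k => d * exp_coeff (c * `|t|) k)).
- by move=> k; exact: normr_ge0.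
- by move=> k; rewrite mulr_ge0// exp_coeff_ge0// mulr_ge0.
- move=> k; rewrite /ecoef /exp_coeff /= exprMn normrM normrX normrM.
  rewrite normfV [`|_`!%:R|]ger0_norm// mulrAC !mulrA.
  rewrite ler_wpM2r ?invr_ge0// ler_wpM2r ?exprn_ge0//.
  rewrite (le_trans (normc_ge_Re _))// mulmx_row_col.
  rewrite (le_trans (normc_sum _ _ _))// mulr_suml ler_sum// => i _.
  rewrite (le_trans (normc_sum _ _ _))// mulr_suml ler_sum// => j _.
  by rewrite Normc.normcM ler_wpM2l ?normc_ge0// normc_exprmx.
have -> : series (fun k => d * exp_coeff (c * `|t|) k) =
    (fun n => d * series (exp_coeff (c * `|t|)) n).
  by apply/funext => k; rewrite /series /= mulr_sumr.
by apply: is_cvgMr; exact: is_cvg_series_exp_coeff.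
Qed.

Lemma exprmxZ n (a : C) (B : 'M[C]_n) k : (a *: B) ^+ k = a ^+ k *: B ^+ k.
Proof.
elim: k => [|k IH]; first by rewrite !expr0 scale1r.
rewrite !exprS IH.
rewrite -[LHS]/(_ *m _) -[B * _]/(B *m _) -scalemxAr -scalemxAl.
by rewrite scalerA mulrC.
Qed.

Lemma cvgr_sum (I : Type) (r : seq I) (f : I -> nat -> R) (a : I -> R) :
  (forall i, f i k @[k --> \oo] --> a i) ->
  \sum_(i <- r) f i k @[k --> \oo] --> \sum_(i <- r) a i.
Proof.
by move=> fa; apply: (@cvg_big _ _ _ _ xpredT (@add_continuous _)).
Qed.

(** [SE] gives the identity for partial sums. Testing with unit vectors shows that these converge
    entrywise to [L], so [expmx] is a true limit; a finite linear combination of entries then passes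
    to the limit. *)
Lemma Re_expmx n (B : 'M[C]_n) (u : 'rV[C]_n) (x : 'cV[C]_n) t :
  complex.Re ((u *m expmx (t%:C *: B) *m x) 0 0) =
  limn (pseries (ecoef B u x) t).
Proof.
pose S : nat -> 'M[C]_n :=
  series (fun k : nat => (k`!%:R)^-1 *: (t%:C *: B) ^+ k).
have SE (u' : 'rV[C]_n) x' k : complex.Re ((u' *m S k *m x') 0 0)
    = pseries (ecoef B u' x') t k.
  rewrite /S /series /pseries /= mulmx_sumr mulmx_suml summxE Re_sumc.
  apply: eq_bigr => l _; rewrite exprmxZ scalerA -scalemxAr -scalemxAl mxE.
  rewrite (_ : _ * _ ^+ l = (l`!%:R^-1 * t ^+ l)%:C); last first.
    by rewrite rmorphM fmorphV rmorph_nat rmorphXn.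
  by rewrite Re_scalec /ecoef; ring.
have coordE k i j : S k i j =
    (delta_mx 0 i *m S k *m delta_mx j 0 : 'M[C]_1) 0 0.
  by rewrite -rowE -colE !mxE.
(* Im z = Re (-i z), so scaling the row vector by -i turns imaginary parts into series of the same
   kind. *)
have IcoordE k i j : complex.Im (S k i j) =
    complex.Re
      (((- (0 +i* 1)) *: delta_mx 0 i *m S k *m delta_mx j 0 : 'M[C]_1) 0 0).
  rewrite -!scalemxAl mxE -coordE; case: (S k i j) => a b /=; ring.
pose L : 'M[C]_n := \matrix_(i, j)
  (limn (pseries (ecoef B (delta_mx 0 i) (delta_mx j 0)) t) +i*
   limn (pseries (ecoef B ((- (0 +i* 1)) *: delta_mx 0 i) (delta_mx j 0)) t)).
have LR i j : complex.Re (S k i j) @[k --> \oo] --> complex.Re (L i j).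
  rewrite mxE /=; under eq_fun do rewrite coordE SE.
  exact: is_cvg_pseries_ecoef.
have LI i j : complex.Im (S k i j) @[k --> \oo] --> complex.Im (L i j).
  rewrite mxE /=; under eq_fun do rewrite IcoordE SE.
  exact: is_cvg_pseries_ecoef.
have -> : expmx (t%:C *: B) = L.
  by apply/cvg_lim; [exact: norm_hausdorff|exact: cvg_cmx].
apply/esym; apply: cvg_lim => //.
have -> : pseries (ecoef B u x) t =
    fun k => complex.Re ((u *m S k *m x) 0 0).
  by apply/funext => k; rewrite SE.
rewrite mulmx_row_col Re_sumc; under eq_fun do rewrite mulmx_row_col Re_sumc.
apply: (cvgr_sum (f := fun i k =>
  complex.Re (\sum_j u 0 i * x j 0 * S k i j))) => i.
rewrite Re_sumc; under eq_fun do rewrite Re_sumc.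
apply: (cvgr_sum (f := fun j k => complex.Re (u 0 i * x j 0 * S k i j))) => j.
rewrite Re_mulc; under eq_fun do rewrite Re_mulc.
by apply: cvgB; apply: cvgMr.
Qed.

Lemma is_derive_expmx n (B : 'M[C]_n) (u : 'rV[C]_n) (x : 'cV[C]_n) t :
  is_derive t (1 : R)
    (fun s : R => complex.Re ((u *m expmx (s%:C *: B) *m x) 0 0))
    (complex.Re ((u *m (B *m expmx (t%:C *: B)) *m x) 0 0)).
Proof.
have -> : (fun s : R => complex.Re ((u *m expmx (s%:C *: B) *m x) 0 0))
    = fun s => limn (pseries (ecoef B u x) s).
  by apply/funext => s; exact: Re_expmx.
rewrite [u *m _]mulmxA (Re_expmx B (u *m B)) -pseries_diffs_ecoef.
(* Termwise differentiation at [t] needs the series and its first two formal derivatives to converge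
   at some point beyond |t|; they converge everywhere, and |t| + 1 is one choice. *)
apply: (@pseries_snd_diffs _ _ (`|t| + 1)).
- exact: is_cvg_pseries_ecoef.
- by rewrite pseries_diffs_ecoef; exact: is_cvg_pseries_ecoef.
- by rewrite !pseries_diffs_ecoef; exact: is_cvg_pseries_ecoef.
by rewrite [ltRHS]ger0_norm ?ltrDl// addr_ge0.
Qed.

Lemma expmx0 n : expmx (0 : 'M[C]_n) = 1%:M.
Proof.
apply/cvg_lim; first exact: norm_hausdorff.
(* The partial sums are constant only from index 1 on, the one at index 0 being empty. *)
apply: cvg_near_cst; near=> k.
rewrite /series /= -(prednK (_ : 0 < k)%N); last by near: k; exists 1%N.
rewrite big_nat_recl// fact0 invr1 scale1r expr0 big1 ?addr0// => l _.
by rewrite expr0n scaler0.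
Unshelve. all: by end_near. Qed.

End MatrixExponential.

(** * Euclidean norm and its real inner product *)

Section EuclideanNorm.
Variable R : realType.
Local Notation C := R[i].

(** The real part of the Hermitian product, that is, the dot product after identifying C^n with
    R^{2n}. *)
Definition rdot n (x y : 'cV[C]_n) : R := \sum_i
  (complex.Re (x i 0) * complex.Re (y i 0) +
   complex.Im (x i 0) * complex.Im (y i 0)).

Lemma rdotC n (x y : 'cV[C]_n) : rdot x y = rdot y x.
Proof. by apply: eq_bigr => i _; rewrite mulrC [in X in _ + X]mulrC. Qed.

Lemma rdotDr n (x y z : 'cV[C]_n) : rdot x (y + z) = rdot x y + rdot x z.
Proof.
rewrite -big_split; apply: eq_bigr => i _.
by rewrite mxE Re_addc Im_addc !mulrDr addrACA.
Qed.

Lemma rdotZr n (a : R) (x y : 'cV[C]_n) : rdot x (a%:C *: y) = a * rdot x y.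
Proof.
rewrite mulr_sumr; apply: eq_bigr => i _.
by rewrite mxE Re_scalec Im_scalec; ring.
Qed.

Lemma rdotDl n (x y z : 'cV[C]_n) : rdot (x + y) z = rdot x z + rdot y z.
Proof. by rewrite !(rdotC _ z) rdotDr. Qed.

Lemma rdotZl n (a : R) (x y : 'cV[C]_n) : rdot (a%:C *: x) y = a * rdot x y.
Proof. by rewrite !(rdotC _ y) rdotZr. Qed.

Lemma rdot_ge0 n (x : 'cV[C]_n) : 0 <= rdot x x.
Proof. by apply: sumr_ge0 => i _; rewrite addr_ge0// -expr2 sqr_ge0. Qed.

Lemma sqr_normc (z : C) :
  Normc.normc z ^+ 2 = complex.Re z ^+ 2 + complex.Im z ^+ 2.
Proof. by case: z => a b /=; rewrite sqr_sqrtr// addr_ge0// sqr_ge0. Qed.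

Lemma vnorm2E n (x : 'cV[C]_n) : vnorm2 x = Num.sqrt (rdot x x).
Proof. by congr Num.sqrt; apply: eq_bigr => i _; rewrite sqr_normc !expr2. Qed.

Lemma vnorm2_ge0 n (x : 'cV[C]_n) : 0 <= vnorm2 x.
Proof. exact: sqrtr_ge0. Qed.

Lemma sqr_vnorm2 n (x : 'cV[C]_n) : vnorm2 x ^+ 2 = rdot x x.
Proof. by rewrite vnorm2E sqr_sqrtr// rdot_ge0. Qed.

Lemma normc_le_vnorm2 n (x : 'cV[C]_n) i : Normc.normc (x i 0) <= vnorm2 x.
Proof.
rewrite -[leLHS]ger0_norm ?normc_ge0// -sqrtr_sqr ler_wsqrtr//.
by rewrite (bigD1 i)//= lerDl sumr_ge0// => j _; rewrite sqr_ge0.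
Qed.

Lemma vnorm2_eq0 n (x : 'cV[C]_n) : (vnorm2 x == 0) = (x == 0).
Proof.
apply/eqP/eqP => [x0|->]; last first.
  by rewrite vnorm2E /rdot big1 ?sqrtr0// => i _; rewrite mxE /= !mulr0 addr0.
apply/matrixP => i j; rewrite ord1 mxE; apply: Normc.eq0_normc.
by apply/le_anti; rewrite normc_ge0 -x0 normc_le_vnorm2.
Qed.

Lemma vnorm2Z n (z : C) (x : 'cV[C]_n) :
  vnorm2 (z *: x) = Normc.normc z * vnorm2 x.
Proof.
rewrite /vnorm2 -[X in X * _](ger0_norm (normc_ge0 _)) -sqrtr_sqr.
rewrite -sqrtrM ?sqr_ge0// mulr_sumr; congr Num.sqrt; apply: eq_bigr => i _.
by rewrite mxE Normc.normcM exprMn.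
Qed.

Lemma normc_real (a : R) : Normc.normc a%:C = `|a|.
Proof. by rewrite /= expr0n addr0 sqrtr_sqr. Qed.

Lemma rdot_le n (x y : 'cV[C]_n) : rdot x y <= vnorm2 x * vnorm2 y.
Proof.
have [/eqP|x0] := eqVneq (vnorm2 x) 0.
  rewrite vnorm2_eq0 => /eqP ->.
  rewrite /rdot big1 ?mulr_ge0 ?vnorm2_ge0// => i _.
  by rewrite mxE /= !mul0r addr0.
have [/eqP|y0] := eqVneq (vnorm2 y) 0.
  rewrite vnorm2_eq0 => /eqP ->.
  rewrite /rdot big1 ?mulr_ge0 ?vnorm2_ge0// => i _.
  by rewrite mxE /= !mulr0 addr0.
have p0 : 0 < vnorm2 x * vnorm2 y by rewrite mulr_gt0// lt0r ?x0 ?y0 vnorm2_ge0.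
(* Cauchy-Schwarz: with p = |x||y| > 0, expanding the square of | |x| y - |y| x | gives 2 p^2 - 2 p
   d >= 0, and p cancels. *)
have := rdot_ge0 ((vnorm2 x)%:C *: y + (- vnorm2 y)%:C *: x).
rewrite !(rdotDl, rdotDr, rdotZl, rdotZr) -!sqr_vnorm2 (rdotC y x).
set d := rdot x y; rewrite -[d <= _](ler_pM2l p0); nra.
Qed.

Lemma vnorm2D n (x y : 'cV[C]_n) : vnorm2 (x + y) <= vnorm2 x + vnorm2 y.
Proof.
rewrite -(ler_pXn2r (_ : 0 < 2)%N) ?nnegrE ?addr_ge0 ?vnorm2_ge0// sqr_vnorm2.
rewrite rdotDl !rdotDr (rdotC y x) -!sqr_vnorm2.
have := rdot_le x y; nra.
Qed.

End EuclideanNorm.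

(** * Operator norm and logarithmic norm *)

Section LogarithmicNorm.
Variable R : realType.
Local Notation C := R[i].

(** A crude bound by row sums; it shows that the set whose [sup] defines [mnorm2] is bounded
    above. *)
Lemma vnorm2_mulmx_bounded m n (B : 'M[C]_(m, n)) :
  exists c : R, forall x, vnorm2 (B *m x) <= c * vnorm2 x.
Proof.
exists (Num.sqrt (\sum_i (\sum_j Normc.normc (B i j)) ^+ 2)) => x.
rewrite -[X in _ * X]ger0_norm ?vnorm2_ge0// -sqrtr_sqr.
rewrite -sqrtrM ?sumr_ge0// => [|i _]; last exact: sqr_ge0.
rewrite ler_wsqrtr// mulr_suml ler_sum// => i _; rewrite -exprMn.
rewrite ler_pXn2r ?nnegrE ?normc_ge0 ?mulr_ge0 ?vnorm2_ge0//; last first.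
  by rewrite sumr_ge0// => j _; exact: normc_ge0.
rewrite mxE (le_trans (normc_sum _ _ _))// mulr_suml ler_sum// => j _.
by rewrite Normc.normcM ler_wpM2l ?normc_ge0// normc_le_vnorm2.
Qed.

Lemma vnorm2_mulmx_le m n (B : 'M[C]_(m, n)) x :
  vnorm2 (B *m x) <= mnorm2 B * vnorm2 x.
Proof.
have [/eqP|x0] := eqVneq (vnorm2 x) 0.
  rewrite vnorm2_eq0 => /eqP ->.
  suff /eqP -> : vnorm2 (B *m (0 : 'cV_n)) == 0.
    suff /eqP -> : vnorm2 (0 : 'cV[C]_n) == 0 by rewrite mulr0.
    by rewrite vnorm2_eq0.
  by rewrite vnorm2_eq0 mulmx0.
have x1 : vnorm2 ((vnorm2 x)^-1%:C *: x) = 1.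
  by rewrite vnorm2Z normc_real ger0_norm ?invr_ge0 ?vnorm2_ge0// mulVf.
rewrite -ler_pdivrMr ?lt0r ?x0 ?vnorm2_ge0//.
have -> : vnorm2 (B *m x) / vnorm2 x = vnorm2 (B *m ((vnorm2 x)^-1%:C *: x)).
  rewrite -scalemxAr vnorm2Z normc_real ger0_norm ?invr_ge0 ?vnorm2_ge0//.
  by rewrite mulrC.
apply: ub_le_sup; last by exists ((vnorm2 x)^-1%:C *: x).
have [c Bc] := vnorm2_mulmx_bounded B.
by exists c => _ [y /= y1 <-]; rewrite (le_trans (Bc y))// y1 mulr1.
Qed.

Lemma exists_unit_vector n (v : 'cV[C]_n) : v != 0 ->
  exists x : 'cV[C]_n, vnorm2 x = 1.
Proof.
rewrite -vnorm2_eq0 => v0; exists ((vnorm2 v)^-1%:C *: v).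
by rewrite vnorm2Z normc_real ger0_norm ?invr_ge0 ?vnorm2_ge0// mulVf.
Qed.

(** The unit vector excludes dimension 0, where the [sup] would be that of an empty set. *)
Lemma mnorm2_le m n (B : 'M[C]_(m, n)) (c : R) :
  (exists x : 'cV[C]_n, vnorm2 x = 1) ->
  (forall x, vnorm2 x = 1 -> vnorm2 (B *m x) <= c) -> mnorm2 B <= c.
Proof.
move=> [x x1] Bc; apply: ge_sup; first by exists (vnorm2 (B *m x)), x.
by move=> _ [y /= y1 <-]; exact: Bc.
Qed.

(* By convexity the difference quotient is monotone, so the limit exists. *)
Lemma cvg_lognorm2 n (B : 'M[C]_n) :
  (exists x : 'cV[C]_n, vnorm2 x = 1) ->
  (mnorm2 (1%:M + h%:C *: B) - 1) / h @[h --> (0 : R)^'+] --> lognorm2 B.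
Proof.
move=> u1; pose q (h : R) := (mnorm2 (1%:M + h%:C *: B) - 1) / h.
have qmono : {in `]0, 1[ &, nondecreasing_fun q}.
  move=> s t; rewrite !in_itv /= => /andP[s0 _] /andP[t0 _] st.
  rewrite /q ler_pdivrMr// mulrAC -mulrA -lerBrDr opprK.
  apply: mnorm2_le => // x x1.
  have st1 : s / t <= 1 by rewrite ler_pdivrMr// mul1r.
  have st0 : 0 <= s / t by rewrite divr_ge0// ltW.
  (* For s <= t, I + sB is the convex combination of I and I + tB with weight s/t on the latter. *)
  have -> : (1%:M + s%:C *: B) *m x =
      (1 - s / t)%:C *: x + (s / t)%:C *: ((1%:M + t%:C *: B) *m x).
    rewrite !mulmxDl !mul1mx -!scalemxAl scalerDr scalerA -rmorphM /=.
    by rewrite divfK ?gt_eqF// addrA -scalerDl -rmorphD /= subrK scale1r.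
  rewrite (le_trans (vnorm2D _ _))// !vnorm2Z !normc_real x1 mulr1.
  rewrite !ger0_norm ?subr_ge0//.
  have := vnorm2_mulmx_le (1%:M + t%:C *: B) x; rewrite x1 mulr1.
  by move/(ler_wpM2l st0); lra.
(* For a unit vector x, 1 <= |(I + hB)x| + h|Bx|, so every quotient is at least -|Bx|. *)
have qlb : has_lbound (q @` [set` `]0, 1[]).
  have [x x1] := u1; exists (- vnorm2 (B *m x)) => _ [h /= + <-].
  rewrite in_itv /= => /andP[h0 _]; rewrite /q ler_pdivlMr//.
  have := vnorm2_mulmx_le (1%:M + h%:C *: B) x.
  have := vnorm2D ((1%:M + h%:C *: B) *m x) ((- h)%:C *: (B *m x)).
  rewrite vnorm2Z normc_real normrN gtr0_norm// x1 mulr1.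
  rewrite mulmxDl mul1mx -scalemxAl -addrA -scalerDl -rmorphD /= subrr scale0r.
  rewrite addr0 x1; lra.
have qcvg : cvg (q h @[h --> (0 : R)^'+]).
  apply/cvg_ex; eexists.
  apply: (@nondecreasing_at_right_cvgr _ q 0 (BLeft 1)) => //.
  by rewrite bnd_simp.
exact: qcvg.
Qed.

(** By Cauchy-Schwarz, |y|^2 + h Re <y, By> = Re <y, (I + hB)y> <= ||I + hB|| |y|^2 for h > 0;
    subtract |y|^2, divide by h and let h tend to 0. Only the limit defining [lognorm2] is used, no
    eigenvalues. *)
Lemma rdot_mulmx_le n (B : 'M[C]_n) (y : 'cV[C]_n) :
  rdot y (B *m y) <= lognorm2 B * rdot y y.
Proof.
have [->|y0] := eqVneq y 0.
  by rewrite mulmx0 /rdot big1 ?mulr0// => i _; rewrite mxE /= !mulr0 addr0.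
have qB := @cvg_lognorm2 _ B (exists_unit_vector y0).
have qBy : (mnorm2 (1%:M + h%:C *: B) - 1) / h * rdot y y @[h --> (0 : R)^'+]
    --> lognorm2 B * rdot y y by exact: cvgMl.
rewrite -(cvg_lim _ qBy)//; apply: limr_ge.
  by apply/cvg_ex; eexists; exact: qBy.
near=> h.
have h0 : 0 < h by near: h; exact: nbhs_right_gt.
rewrite mulrAC ler_pdivlMr// mulrBl mul1r lerBrDr.
have := rdot_le y ((1%:M + h%:C *: B) *m y).
rewrite mulmxDl mul1mx -scalemxAl rdotDr rdotZr.
have := vnorm2_mulmx_le (1%:M + h%:C *: B) y.
rewrite mulmxDl mul1mx -scalemxAl => /(ler_wpM2l (vnorm2_ge0 y)).
rewrite -sqr_vnorm2; lra.
Unshelve. all: by end_near. Qed.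

End LogarithmicNorm.

(** * Differential inequality for the norm of a curve *)

Section ErrorBound.
Variable R : realType.
Local Notation C := R[i].

(* Testing against [u] and ['i *: u] captures real and imaginary parts, and only
   derivatives of real functions of a real variable are involved. *)
Definition is_cderive n (y : R -> 'cV[C]_n) (t : R) (d : 'cV[C]_n) :=
  forall u : 'rV[C]_n, is_derive t (1 : R)
    (fun s : R => complex.Re ((u *m y s) 0 0)) (complex.Re ((u *m d) 0 0)).

Lemma Re_delta_mulmx n (x : 'cV[C]_n) i :
  complex.Re (x i 0) = complex.Re (((delta_mx 0 i : 'rV_n) *m x) 0 0).
Proof. by rewrite -rowE mxE. Qed.

Lemma Im_delta_mulmx n (x : 'cV[C]_n) i :
  complex.Im (x i 0) =
  complex.Re (((- (0 +i* 1)) *: (delta_mx 0 i : 'rV_n) *m x) 0 0).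
Proof. by rewrite -scalemxAl mxE -rowE mxE; case: (x i 0) => a b /=; ring. Qed.

Lemma is_derive_Re n (y : R -> 'cV[C]_n) t d i : is_cderive y t d ->
  is_derive t (1 : R) (fun s : R => complex.Re (y s i 0)) (complex.Re (d i 0)).
Proof.
move=> yd; rewrite Re_delta_mulmx.
by under eq_fun do rewrite Re_delta_mulmx; exact: yd.
Qed.

Lemma is_derive_Im n (y : R -> 'cV[C]_n) t d i : is_cderive y t d ->
  is_derive t (1 : R) (fun s : R => complex.Im (y s i 0)) (complex.Im (d i 0)).
Proof.
move=> yd; rewrite Im_delta_mulmx.
by under eq_fun do rewrite Im_delta_mulmx; exact: yd.
Qed.

Lemma is_derive_rdot n (y : R -> 'cV[C]_n) t d : is_cderive y t d ->
  is_derive t (1 : R) (fun s : R => rdot (y s) (y s)) (2 * rdot (y t) d).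
Proof.
move=> yd.
have -> : (fun s : R => rdot (y s) (y s)) = \sum_i
    ((fun s : R => complex.Re (y s i 0)) ^+ 2 +
     (fun s : R => complex.Im (y s i 0)) ^+ 2).
  apply/funext => s; rewrite fct_sumE; apply: eq_bigr => i _.
  by rewrite -!expr2.
rewrite mulr_sumr; apply: is_derive_sum => i.
have dR := is_derive_Re i yd; have dI := is_derive_Im i yd.
by apply: is_derive_eq; rewrite /GRing.scale /=; ring.
Qed.

(** [psi t] is the integral of e^{-mu s} over [0, t], taken in closed form: t if mu = 0 and (1 -
    e^{-mu t})/mu otherwise. The last clause is how [phi1] enters the bound. *)
Lemma expR_primitive (mu : R) : exists psi : R -> R,
  [/\ psi 0 = 0,
      forall t : R, is_derive t (1 : R) psi (expR (- (mu * t)))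
    & forall t, expR (mu * t) * psi t = t * phi1 (t * mu)].
Proof.
have [->|mu0] := eqVneq mu 0.
  exists id; split => // t; rewrite mul0r ?oppr0 expR0; first exact: is_derive_id.
  by rewrite mulr0 /phi1 eqxx mulr1 mul1r.
exists (fun t => mu^-1 * (1 - expR (- (mu * t)))); split.
- by rewrite mulr0 oppr0 expR0 subrr mulr0.
- move=> t.
  have dl : is_derive t (1 : R) (fun s : R => - (mu * s)) (- mu).
    apply: (@is_derive_eq _ _ _ (- (mu \*: (@id R)))); rewrite /GRing.scale /=.
    by rewrite mulr1.
  have -> : (fun t : R => mu^-1 * (1 - expR (- (mu * t)))) =
    mu^-1 \*: (cst 1 - (expR \o (fun s : R => - (mu * s)))) by [].
  apply: is_derive_eq; rewrite /GRing.scale /=; field.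
  exact: mu0.
move=> t; rewrite /phi1; have [->|t0] := eqVneq t 0.
  by rewrite !mul0r mulr0 oppr0 expR0 subrr !mulr0.
rewrite mulf_eq0 (negbTE t0) (negbTE mu0) /= mulrCA mulrBr mulr1 -expRD subrr expR0.
by rewrite (mulrC mu); field; rewrite t0 mu0.
Qed.

Lemma le_of_forall_le_addM (a b k : R) :
  (forall e, 0 < e -> a <= b + e * k) -> a <= b.
Proof.
move=> ab; apply/ler_addgt0Pr => e e0.
have k0 : 0 < `|k| + 1 by rewrite ltr_pwDr.
rewrite (le_trans (ab (e / (`|k| + 1)) _)) ?divr_gt0// lerD2l.
rewrite mulrAC ler_pdivrMr// ler_wpM2l ?(ltW e0)//.
by rewrite (le_trans (ler_norm _))// lerDl.
Qed.

(* [vnorm2 (y t)] need not be differentiable where [y] vanishes, so the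
   differential inequality is integrated for [sqrt (|y|^2 + e^2)], [e -> 0]. *)
Lemma lognorm2_gronwall n (B : 'M[C]_n) (y r : R -> 'cV[C]_n) (tau c : R) :
  0 <= tau -> y 0 = 0 ->
  (forall t, is_cderive y t (B *m y t + r t)) ->
  (forall t, 0 <= t <= tau -> vnorm2 (r t) <= c) ->
  vnorm2 (y tau) <= c * (tau * phi1 (tau * lognorm2 B)).
Proof.
move=> tau0 y0 dy rc; set mu := lognorm2 B.
have [psi [psi0 dpsi psiE]] := expR_primitive mu.
rewrite -psiE.
suff H : forall e, 0 < e ->
    expR (- (mu * tau)) * vnorm2 (y tau) <=
    c * psi tau + e * (1 + `|mu| * psi tau).
  have := le_of_forall_le_addM H; rewrite expRN mulrC ler_pdivrMr ?expR_gt0//.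
  by move/le_trans; apply; rewrite mulrAC mulrA.
move=> e e0.
pose p t := rdot (y t) (y t) + e ^+ 2.
pose u t := Num.sqrt (p t).
have p0 t : 0 < p t by rewrite ltr_wpDl ?rdot_ge0// exprn_gt0.
have u0 t : 0 < u t by rewrite sqrtr_gt0.
have uE t : u t ^+ 2 = vnorm2 (y t) ^+ 2 + e ^+ 2.
  by rewrite sqr_sqrtr ?(ltW (p0 t))// sqr_vnorm2.
have ue t : e <= u t.
  rewrite -(ler_pXn2r (_ : 0 < 2)%N) ?nnegrE ?(ltW e0) ?(ltW (u0 t))//.
  by rewrite uE lerDr sqr_ge0.
have uy t : vnorm2 (y t) <= u t.
  rewrite -(ler_pXn2r (_ : 0 < 2)%N) ?nnegrE ?vnorm2_ge0 ?(ltW (u0 t))//.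
  by rewrite uE lerDl sqr_ge0.
have du t : is_derive t (1 : R) u (rdot (y t) (B *m y t + r t) / u t).
  have dp : is_derive t (1 : R) p (2 * rdot (y t) (B *m y t + r t)).
    have := is_derive_rdot (dy t) => ?.
    have -> : p = (fun s => rdot (y s) (y s)) + cst (e ^+ 2) by [].
    by apply: is_derive_eq; rewrite addr0.
  have ds := is_derive1_sqrt (p0 t).
  have -> : u = Num.sqrt \o p by [].
  apply: is_derive_eq; rewrite /= -/(u t); field.
  by rewrite gt_eqF.
have de t : is_derive t (1 : R) (fun s => expR (- (mu * s)))
    (- mu * expR (- (mu * t))).
  have dl : is_derive t (1 : R) (fun s : R => - (mu * s)) (- mu).
    apply: (@is_derive_eq _ _ _ (- (mu \*: (@id R)))); rewrite /GRing.scale /=.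
    by rewrite mulr1.
  have -> : (fun s => expR (- (mu * s))) =
      expR \o (fun s : R => - (mu * s)) by [].
  by apply: is_derive_eq; rewrite mulrC.
(* Integrating factor: u' <= mu u + c + |mu| e on the interval makes [F] nonincreasing there, since
   [psi] is a primitive of e^{-mu s}. *)
pose F := (fun s => expR (- (mu * s))) * u - (c + `|mu| * e) \*: psi.
have dF t : is_derive t (1 : R) F (expR (- (mu * t)) *
    (rdot (y t) (B *m y t + r t) / u t - mu * u t - (c + `|mu| * e))).
  by apply: is_derive_eq; rewrite /GRing.scale /=; ring.
have : F tau <= F 0.
  have i0 : 0 \in `[0, tau] by rewrite in_itv /= lexx tau0.
  have it : tau \in `[0, tau] by rewrite in_itv /= lexx tau0.
  apply: (@ler0_derive1_le_cc _ F 0 tau _ _ _ tau 0) => //.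
  - move=> t; rewrite in_itv /= => /andP[t0 tt].
    rewrite derive1E (@derive_val _ _ _ _ _ _ _ (dF t)).
    rewrite pmulr_rle0 ?expR_gt0// -addrA -opprD subr_le0 ler_pdivrMr//.
    have rt : vnorm2 (r t) <= c by apply: rc; rewrite !ltW.
    rewrite rdotDr.
    apply: le_trans (lerD (rdot_mulmx_le B (y t)) (rdot_le (y t) (r t))) _.
    rewrite -/mu -sqr_vnorm2.
    (* The goal is the inequality for u' multiplied by u. Writing |y|^2 = u^2 - e^2 leaves an excess
       -mu e^2 <= |mu| e^2 <= |mu| e u, while |y||r| <= c |y| <= c u. *)
    have := ler_wpM2l (vnorm2_ge0 (y t)) rt.
    have c0 : 0 <= c by exact: le_trans (vnorm2_ge0 _) rt.
    have := ler_wpM2l c0 (uy t).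
    have := ler_wpM2l (mulr_ge0 (normr_ge0 mu) (ltW e0)) (ue t).
    have -> : vnorm2 (y t) ^+ 2 = u t ^+ 2 - e ^+ 2 by rewrite uE addrK.
    have := ler_wpM2r (sqr_ge0 e) (ler_norm (- mu)); rewrite normrN; nra.
  apply: continuous_subspaceT => t.
  by apply: differentiable_continuous; apply/derivable1_diffP; have [] := dF t.
(* As y and psi vanish at 0, [F 0] is sqrt (e^2) = e; at [tau], u dominates |y|. *)
rewrite /F /u /p /= !fctE /= psi0 y0 /GRing.scale /=.
rewrite mulr0 oppr0 expR0 mul1r mulr0 subr0 -/(p tau) -/(u tau).
have -> : rdot (0 : 'cV[C]_n) 0 = 0.
  by rewrite /rdot big1// => i _; rewrite mxE /= !mulr0 addr0.
rewrite add0r sqrtr_sqr (gtr0_norm e0).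
have := ler_wpM2l (expR_ge0 (- (mu * tau))) (uy tau); lra.
Qed.

Lemma is_cderive_expmx n (B : 'M[C]_n) (x : 'cV[C]_n) t :
  is_cderive (fun s : R => expmx (s%:C *: B) *m x) t
    (B *m expmx (t%:C *: B) *m x).
Proof.
move=> u; under eq_fun do rewrite mulmxA.
by rewrite mulmxA; exact: is_derive_expmx.
Qed.

Lemma is_cderive_mulmx m n (M : 'M[C]_(m, n)) (y : R -> 'cV[C]_n) t d :
  is_cderive y t d -> is_cderive (fun s => M *m y s) t (M *m d).
Proof.
by move=> yd u; under eq_fun do rewrite mulmxA; rewrite mulmxA; exact: yd.
Qed.

Lemma is_cderiveB n (x y : R -> 'cV[C]_n) t dx dy :
  is_cderive x t dx -> is_cderive y t dy ->
  is_cderive (fun s => x s - y s) t (dx - dy).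
Proof.
move=> xd yd u; have xdu := xd u; have ydu := yd u.
have ReB (a b : 'cV[C]_n) : complex.Re ((u *m (a - b)) 0 0) =
    complex.Re ((u *m a) 0 0) - complex.Re ((u *m b) 0 0).
  by rewrite mulmxBr !mxE; case: (\sum_j _) (\sum_j _) => [? ?] [? ?].
by under eq_fun do rewrite ReB; rewrite ReB; exact: is_deriveB.
Qed.

(** Provides the continuity needed for |e_m^T e^{-tH} e_1| to attain its maximum on [0, tau]. *)
Lemma is_cderive_continuous_normc n (y : R -> 'cV[C]_n) (d : R -> 'cV[C]_n) i :
  (forall t, is_cderive y t (d t)) ->
  continuous (fun s => Normc.normc (y s i 0)).
Proof.
move=> yd t.
have -> : (fun s => Normc.normc (y s i 0)) = (fun s =>
    Num.sqrt (complex.Re (y s i 0) ^+ 2 + complex.Im (y s i 0) ^+ 2)).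
  by apply/funext => s; case: (y s i 0).
have dcont (f : R -> R) df : is_derive t (1 : R) f df -> {for t, continuous f}.
  by case=> fd _; apply: differentiable_continuous; exact/derivable1_diffP.
apply: (@continuous_comp _ _ _ (fun s =>
  complex.Re (y s i 0) ^+ 2 + complex.Im (y s i 0) ^+ 2) Num.sqrt); last first.
  exact: sqrt_continuous.
by apply: continuousD; apply: continuousM;
  [exact: dcont (is_derive_Re i (yd t))|exact: dcont (is_derive_Re i (yd t))
  |exact: dcont (is_derive_Im i (yd t))|exact: dcont (is_derive_Im i (yd t))].
Qed.

End ErrorBound.

(** * The Arnoldi error bound *)

Theorem theorem4p1 (R : realType) (N k : nat) (A : 'M[R[i]]_N)
    (v : 'cV[R[i]]_N) (tau : R) (V : 'M[R[i]]_(N, k.+1))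
    (H : 'M[R[i]]_k.+1) (h : R) (w : 'cV[R[i]]_N) :
  v != 0 -> 0 < tau -> arnoldi A v V H h w ->
  let beta := vnorm2 v in
  let e1 : 'cV[R[i]]_k.+1 := delta_mx ord0 0 in
  let em : 'cV[R[i]]_k.+1 := delta_mx ord_max 0 in
  let E := expmx (- (tau%:C *: A)) *m v
           - beta%:C *: (V *m expmx (- (tau%:C *: H)) *m e1) in
  let g := fun t : R => Normc.normc ((em^T *m expmx (- (t%:C *: H)) *m e1) 0 0) in
  let mu2 := lognorm2 (- A) in
  (* M is the maximum of g over [0, tau] *)
  exists2 M : R,
    (g @` `[0, tau]) M /\ ubound (g @` `[0, tau]) M &
    vnorm2 E <= tau * beta * h * M * phi1 (tau * mu2).
Proof.
move=> v0 tau0 arn beta e1 em E g mu2.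
have beta0 : 0 < beta by rewrite lt0r vnorm2_ge0 vnorm2_eq0 v0.
pose X (t : R) := expmx (t%:C *: - H) *m e1.
have dX t : is_cderive X t (- H *m X t).
  by rewrite mulmxA; exact: is_cderive_expmx.
have gE : g = fun t => Normc.normc (X t ord_max 0).
  by apply/funext => t; rewrite /g /X /em trmx_delta -mulmxA -rowE mxE scalerN.
have [t0 t0tau gmax] : exists2 c, c \in `[0, tau] &
    forall t, t \in `[0, tau] -> g t <= g c.
  apply: EVT_max; first exact: ltW.
  apply: continuous_subspaceT; rewrite gE.
  exact: (is_cderive_continuous_normc dX).
exists (g t0).
  by split; [exists t0|move=> _ [t /= tt <-]; exact: gmax].
pose y (t : R) := expmx (t%:C *: - A) *m v - (beta%:C *: V) *m X t.
(* The forcing term, produced by the rank-one remainder of the Arnoldi relation applied to -beta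
   e^{-tH} e_1. *)
pose r (t : R) := (- (beta * h)%:C * X t ord_max 0) *: w.
have yE : E = y tau.
  by rewrite /E /y /X !scalerN -!scalemxAl !mulmxA.
have y0 : y 0 = 0.
  (* At t = 0 both exponentials are I, and beta V e_1 = v because the first column of [V] is v /
     beta. *)
  rewrite /y /X !scale0r !expmx0 !mul1mx -scalemxAl -colE (arnoldi_first arn).
  by rewrite scalerA -rmorphM divff ?gt_eqF// scale1r subrr.
have AVZ Z : A *m (V *m Z) = V *m (H *m Z) + h%:C *: (Z ord_max 0 *: w).
  rewrite mulmxA (arnoldi_relation arn) mulmxDl -mulmxA -scalemxAl.
  congr (_ + _ *: _); rewrite -mulmxA trmx_delta -rowE; apply/matrixP => i j.
  by rewrite !mxE big_ord1 !ord1 mxE mulrC.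
have dy t : is_cderive y t (- A *m y t + r t).
  have -> : - A *m y t + r t =
      - A *m expmx (t%:C *: - A) *m v - (beta%:C *: V) *m (- H *m X t).
    (* Once the terms with e^{-tA} v are matched, [AVZ] turns beta A V X into beta V H X plus a
       multiple of w; that multiple cancels against [r]. *)
    rewrite /y mulmxBr (mulmxA (- A)) -addrA; congr (_ + _).
    rewrite !mulNmx !mulmxN !opprK -!scalemxAl -scalemxAr AVZ scalerDr -addrA.
    rewrite -[RHS]addr0; congr (_ + _).
    by rewrite /r !scalerA -scalerDl rmorphM /= mulNr mulrA subrr scale0r.
  apply: is_cderiveB; first exact: is_cderive_expmx.
  exact/is_cderive_mulmx/dX.
have h0 := ltW (arnoldi_next_gt0 arn).
have rb t : 0 <= t <= tau -> vnorm2 (r t) <= beta * h * g t0.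
  move=> tt; rewrite /r vnorm2Z (arnoldi_next_unit arn) mulr1 Normc.normcM.
  rewrite normcN normc_real ger0_norm ?mulr_ge0 ?(ltW beta0)//.
  rewrite ler_wpM2l ?mulr_ge0 ?(ltW beta0)//.
  (* Since |w| = 1, the norm of [r t] is beta h [g t], and [t0] maximizes [g]. *)
  by have := gmax t; rewrite gE; apply; rewrite in_itv.
rewrite yE (le_trans (lognorm2_gronwall (ltW tau0) y0 dy rb))//.
by rewrite -/mu2 mulrCA !mulrA.
Qed.
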